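(* (Fundamental Theorem of Homomorphisms of Hom-groups) Let $(G,\beta)$ and $(H,\alpha)$ be two Hom-groups. If $f:(G,\beta)\to(H,\alpha)$ is an epimorphism of Hom-groups, then $G/\mathrm{Ker} f\cong H$ as Hom-groups.
   Context: A Hom-group $(G,\alpha)$ is a set $G$ together with a distinguished element $1=1_G\in G$ (the unit), a bijective map $\alpha:G\to G$ and a binary operation $G\times G\to G$, $(g,h)\mapsto gh$, such that for all $g,h,k\in G$: (1) $\alpha(g)(hk)=(gh)\alpha(k)$; (2) $\alpha(gh)=\alpha(g)\alpha(h)$; (3) $g1=1g=\alpha(g)$; (4) there exists $g^{-1}\in G$ with $gg^{-1}=g^{-1}g=1$. A Hom-subgroup of a Hom-group $(G,\alpha)$ is a nonempty subset $N\subseteq G$ closed under the product such that $(N,\alpha)$ (with $\alpha$ restricted to a bijection $N\to N$) is itself a Hom-group under the product of $G$; it is Hom-normal if $gN=Ng$ for every $g\in G$, where $gN=\{gn\mid n\in N\}$ and $Ng=\{ng\mid n\in N\}$. For $N$ Hom-normal in $(G,\alpha)$, $G/N$ denotes the Hom-group of left cosets $gN$, with product $(aN)(bN)=(ab)N$ and twisting map $\widetilde{\alpha}(aN)=\alpha(a)N$. A homomorphism of Hom-groups $f:(G,\beta)\to(H,\alpha)$ is a map with $f(gk)=f(g)f(k)$ for all $g,k\in G$ and $\alpha(f(g))=f(\beta(g))$ for all $g\in G$. It is an epimorphism if it is surjective, and an isomorphism if it is bijective; $\cong$ means that an isomorphism exists. $\mathrm{Ker} f=\{g\in G\mid f(g)=1_H\}$,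 which is a Hom-normal subgroup of $G$. *)

(* Defs.v *)
From HB Require Import structures.
From mathcomp Require Import all_boot.
From mathcomp Require Import boolp classical_sets.

Set Implicit Arguments.
Unset Strict Implicit.
Unset Printing Implicit Defensive.

Declare Scope homgroup_scope.
Delimit Scope homgroup_scope with HG.

Local Open Scope classical_set_scope.

Record hom_group_axioms (T : Type) (mul : T -> T -> T) (one : T)
    (twist : T -> T) : Prop := HomGroupAxioms {
  twist_bij_ax : bijective twist;
  hom_assoc_ax : forall g h k, mul (twist g) (mul h k) = mul (mul g h) (twist k);
  twistM_ax : forall g h, twist (mul g h) = mul (twist g) (twist h);
  hom_mulr1_ax : forall g, mul g one = twist g;
  hom_mul1r_ax : forall g, mul one g = twist g;
  hom_inv_ax : forall g, exists g', mul g g' = one /\ mul g' g = one }.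

HB.mixin Record isHomGroup (G : Type) := {
  hmul : G -> G -> G;
  hone : G;
  twist : G -> G;
  hom_groupP : hom_group_axioms hmul hone twist }.

#[short(type="homGroupType")]
HB.structure Definition HomGroup := { G of isHomGroup G }.

Notation "1" := (@hone _) : homgroup_scope.
Notation "x * y" := (hmul x y) : homgroup_scope.

Local Open Scope homgroup_scope.

HB.mixin Record isHomGroupMorphism (G H : homGroupType) (f : G -> H) := {
  hmorphM : forall g k : G, f (g * k) = f g * f k;
  hmorph_twist : forall g : G, twist (f g) = f (twist g) }.

#[short(type="homGroupMorphism")]
HB.structure Definition HomGroupMorphism (G H : homGroupType) :=
  { f of isHomGroupMorphism G H f }.

Definition hom_epimorphism (G H : homGroupType) (f : homGroupMorphism G H) :=
  forall h : H, exists g : G, f g = h.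

Definition hom_isomorphic (G H : homGroupType) :=
  exists f : homGroupMorphism G H, bijective f.

(* Closure under the product and stability under the twisting map are carried
   by the codomains of [mulN] and [twistN]; bijectivity of [twistN] and the
   unit [e] are part of the Hom-group axioms.  The unit [e] of the restricted structure is not required to be the unit of
   the ambient Hom-group. *)
Definition hom_subgroup (G : homGroupType) (N : set G) : Prop :=
  N !=set0 /\
  exists (mulN : N -> N -> N) (e : N) (twistN : N -> N),
    [/\ forall x y : N, val (mulN x y) = val x * val y,
        forall x : N, val (twistN x) = twist (val x)
      & hom_group_axioms mulN e twistN].

Definition lcoset (G : homGroupType) (g : G) (N : set G) : set G :=
  [set g * n | n in N].

Definition rcoset (G : homGroupType) (N : set G) (g : G) : set G :=
  [set n * g | n in N].

Definition hom_normal (G : homGroupType) (N : set G) : Prop :=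
  hom_subgroup N /\ forall g : G, lcoset g N = rcoset N g.

Record homNormal (G : homGroupType) := HomNormal {
  homNormal_set :> set G;
  homNormalP : hom_normal homNormal_set }.

Section HomGroupTheory.
Variable G : homGroupType.
Implicit Types (g h k : G) (N : set G).

Lemma twist_bij : bijective (@twist G).
Proof. by case: (@hom_groupP G). Qed.
Lemma twist_inj : injective (@twist G).
Proof. exact: bij_inj twist_bij. Qed.
Lemma twist_surj g : exists h, twist h = g.
Proof. by have [t _ K] := twist_bij; exists (t g). Qed.
Lemma hom_assoc g h k : twist g * (h * k) = (g * h) * twist k.
Proof. by case: (@hom_groupP G). Qed.
Lemma twistM g h : twist (g * h) = twist g * twist h.
Proof. by case: (@hom_groupP G). Qed.
Lemma hmulr1 g : g * 1 = twist g.
Proof. by case: (@hom_groupP G). Qed.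
Lemma hmul1r g : 1 * g = twist g.
Proof. by case: (@hom_groupP G). Qed.
Lemma hmul_inv g : exists g', g * g' = 1 /\ g' * g = 1.
Proof. by case: (@hom_groupP G). Qed.

Lemma hmulI g h k : g * h = g * k -> h = k.
Proof.
have [g' [_ gK]] := hmul_inv g; move=> /(congr1 (hmul (twist g'))).
by rewrite !hom_assoc gK !hmul1r => /twist_inj/twist_inj.
Qed.

Lemma hmulIr g h k : h * g = k * g -> h = k.
Proof.
have [g' [gK _]] := hmul_inv g; move=> /(congr1 (fun x => x * twist g')).
by rewrite -!hom_assoc gK !hmulr1 => /twist_inj/twist_inj.
Qed.

Lemma twist1 : twist 1 = 1 :> G.
Proof.
have [u u1] := twist_surj (1 : G).
have uu : u * u = 1 by apply: twist_inj; rewrite twistM u1 hmulr1.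
suff e : u = 1 by move: u1; rewrite e.
apply: (@hmulI u); apply: twist_inj.
by rewrite -[LHS]hmulr1 -{1}u1 -hom_assoc uu !hmulr1.
Qed.

Lemma hmulr_solve g c : exists x, g * x = c.
Proof.
have [k kg] := twist_surj g; have [k' [kK _]] := hmul_inv k.
have [d dc] := twist_surj c; have [h hd] := twist_surj d.
by exists (k' * h); rewrite -kg hom_assoc kK hmul1r hd dc.
Qed.

Lemma hmull_solve g c : exists x, x * g = c.
Proof.
have [k kg] := twist_surj g; have [k' [_ kK]] := hmul_inv k.
have [d dc] := twist_surj c; have [h hd] := twist_surj d.
by exists (h * k'); rewrite -kg -hom_assoc kK hmulr1 hd dc.
Qed.

End HomGroupTheory.

Section HomSubgroupTheory.
Variables (G : homGroupType) (N : set G).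
Hypothesis sN : hom_subgroup N.

Lemma hom_subgroupM x y : N x -> N y -> N (x * y).
Proof.
have [_ [m [e [t [mE _ _]]]]] := sN => /mem_set Nx /mem_set Ny.
by have := set_valP (m (SigSub Nx) (SigSub Ny)); rewrite mE.
Qed.

Lemma hom_subgroup_twist x : N x -> N (twist x).
Proof.
have [_ [m [e [t [_ tE _]]]]] := sN => /mem_set Nx.
by have := set_valP (t (SigSub Nx)); rewrite tE.
Qed.

Lemma hom_subgroup_untwist x : N x -> exists2 y, N y & twist y = x.
Proof.
have [_ [m [e [t [_ tE [[t' _ tK] _ _ _ _ _]]]]]] := sN => /mem_set Nx.
by exists (val (t' (SigSub Nx))); [exact: set_valP | rewrite -tE tK].
Qed.

Lemma hom_subgroup_inv x : N x -> exists2 y, N y & x * y = 1.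
Proof.
have [_ [m [e [t [mE tE [_ _ _ er _ iv]]]]]] := sN => /mem_set Nx.
have e1 : val e = 1 by apply: (@hmulI _ (val e)); rewrite -mE er tE hmulr1.
have [y [xy _]] := iv (SigSub Nx).
by exists (val y); [exact: set_valP | rewrite -e1 -xy mE].
Qed.

Lemma lcosetP a b :
  lcoset a N = lcoset b N <-> exists2 n, N n & a * n = twist b.
Proof.
have N1 : N 1.
  have [[x Nx] _] := sN; have [y Ny <-] := hom_subgroup_inv Nx.
  exact: hom_subgroupM Nx Ny.
have sub c d n : N n -> c * n = twist d -> lcoset d N `<=` lcoset c N.
  move=> Nn cn _ [m Nm <-].
  have [p Np pE] := hom_subgroup_untwist (hom_subgroupM Nn Nm).
  by exists p => //; apply: twist_inj; rewrite !twistM pE hom_assoc cn.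
split=> [ab|[n Nn abn]].
  have : lcoset b N (twist b) by exists 1 => //; rewrite hmulr1.
  by rewrite -ab => -[n Nn nE]; exists n.
have [n' Nn' nK] := hom_subgroup_inv Nn.
rewrite eqEsubset; split; last exact: sub Nn abn.
apply: (sub b a n') => //; apply: twist_inj.
by rewrite twistM -abn -hom_assoc nK hmulr1.
Qed.

End HomSubgroupTheory.

Definition hom_quotient (G : homGroupType) (N : homNormal G) : Type :=
  range (fun a : G => lcoset a N).

Section HomQuotient.
Variables (G : homGroupType) (N : homNormal G).
Local Notation Q := (hom_quotient N).

Let sN : hom_subgroup N := proj1 (homNormalP N).

Definition coset (a : G) : Q :=
  SigSub (mem_set (imageT (fun b : G => lcoset b N) a)).

Lemma coset_eqP a b : coset a = coset b <-> exists2 n, (N : set G) n & a * n = twist b.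
Proof.
rewrite -(lcosetP sN); split=> [/(congr1 val)//|ab].
exact: val_inj.
Qed.

Lemma coset_surj (A : Q) : exists a, coset a = A.
Proof. by have [a _ aA] := set_valP A; exists a; apply: val_inj. Qed.

Definition coset_repr (A : Q) : G := projT1 (cid (coset_surj A)).

Lemma coset_reprK A : coset (coset_repr A) = A.
Proof. exact: projT2 (cid (coset_surj A)). Qed.

(* Defined through chosen representatives; [quotient_mulE] and
   [quotient_twistE] below show independence of the choice, i.e.
   (aN)(bN) = (ab)N and the twisting map sends aN to (twist a)N. *)
Definition quotient_mul (A B : Q) : Q := coset (coset_repr A * coset_repr B).
Definition quotient_twist (A : Q) : Q := coset (twist (coset_repr A)).

Lemma quotient_mulE a b : quotient_mul (coset a) (coset b) = coset (a * b).
Proof.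
rewrite /quotient_mul.
have /coset_eqP[n Nn an] := coset_reprK (coset a).
have /coset_eqP[m Nm bm] := coset_reprK (coset b).
move: (coset_repr _) (coset_repr _) an bm => b' a' an bm.
transitivity (coset (a' * b)); apply/coset_eqP.
  exists (twist m); first exact: hom_subgroup_twist.
  by rewrite twistM -bm hom_assoc.
have : rcoset N b (n * b) by exists n.
have [_ <-] := homNormalP N => -[n' Nn' n'E].
exists (twist n'); first exact: hom_subgroup_twist.
by rewrite twistM -an -[RHS]hom_assoc -n'E hom_assoc.
Qed.

Lemma quotient_twistE a : quotient_twist (coset a) = coset (twist a).
Proof.
rewrite /quotient_twist.
have /coset_eqP[n Nn an] := coset_reprK (coset a).
apply/coset_eqP; exists (twist n); first exact: hom_subgroup_twist.
by rewrite -twistM an.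
Qed.

Lemma quotient_hom_group :
  hom_group_axioms quotient_mul (coset 1) quotient_twist.
Proof.
split.
- have inj : injective quotient_twist.
    move=> A B; have [a <-] := coset_surj A; have [b <-] := coset_surj B.
    rewrite !quotient_twistE => /coset_eqP[n Nn ab]; apply/coset_eqP.
    have [m Nm mE] := hom_subgroup_untwist sN Nn.
    by exists m => //; apply: twist_inj; rewrite twistM mE.
  have surj B : exists A, quotient_twist A = B.
    have [b <-] := coset_surj B; have [a <-] := twist_surj b.
    by exists (coset a); rewrite quotient_twistE.
  pose t B := projT1 (cid (surj B)).
  have tK B : quotient_twist (t B) = B := projT2 (cid (surj B)).
  by exists t => // A; apply: inj; rewrite tK.
- move=> A B C; have [a <-] := coset_surj A; have [b <-] := coset_surj B.
  have [c <-] := coset_surj C.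
  by rewrite !quotient_twistE !quotient_mulE hom_assoc.
- move=> A B; have [a <-] := coset_surj A; have [b <-] := coset_surj B.
  by rewrite quotient_mulE !quotient_twistE quotient_mulE twistM.
- move=> A; have [a <-] := coset_surj A.
  by rewrite quotient_mulE quotient_twistE hmulr1.
- move=> A; have [a <-] := coset_surj A.
  by rewrite quotient_mulE quotient_twistE hmul1r.
- move=> A; have [a <-] := coset_surj A; have [b [ab ba]] := hmul_inv a.
  by exists (coset b); rewrite !quotient_mulE ab ba.
Qed.

HB.instance Definition _ := isHomGroup.Build Q quotient_hom_group.

End HomQuotient.

Section HomKernel.
Variables (G H : homGroupType) (f : homGroupMorphism G H).

Definition hom_ker_set : set G := [set g | f g = 1].

Lemma hmorph1 : f 1 = 1.
Proof. by apply: (@hmulI _ (f 1)); rewrite -hmorphM !hmulr1 hmorph_twist. Qed.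

Lemma hom_ker_normal : hom_normal hom_ker_set.
Proof.
split.
  have K1 : 1 \in hom_ker_set by apply/mem_set/hmorph1.
  have KM (x y : hom_ker_set) : val x * val y \in hom_ker_set.
    apply/mem_set; rewrite /hom_ker_set /= hmorphM.
    by rewrite (set_valP x) (set_valP y) hmulr1 twist1.
  have Kt (x : hom_ker_set) : twist (val x) \in hom_ker_set.
    by apply/mem_set; rewrite /hom_ker_set /= -hmorph_twist (set_valP x) twist1.
  split; first by exists 1; exact: hmorph1.
  exists (fun x y => SigSub (KM x y)), (SigSub K1), (fun x => SigSub (Kt x)).
  split=> //; split.
  - have [t tK Kt'] := twist_bij G.
    have Kt1 (x : hom_ker_set) : t (val x) \in hom_ker_set.
      apply/mem_set; apply: twist_inj.
      by rewrite hmorph_twist Kt' (set_valP x) twist1.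
    by exists (fun x => SigSub (Kt1 x)) => x; apply: val_inj; rewrite /= ?tK ?Kt'.
  - by move=> x y z; apply: val_inj; rewrite /= hom_assoc.
  - by move=> x y; apply: val_inj; rewrite /= twistM.
  - by move=> x; apply: val_inj; rewrite /= hmulr1.
  - by move=> x; apply: val_inj; rewrite /= hmul1r.
  - move=> x; have [y [xy yx]] := hmul_inv (val x).
    have Ky : y \in hom_ker_set.
      apply/mem_set; apply: twist_inj.
      by rewrite -hmul1r -{1}(set_valP x) -hmorphM xy hmorph1 twist1.
    by exists (SigSub Ky); split; apply: val_inj.
move=> g; rewrite eqEsubset; split=> _ [n Kn <-].
  have [x xE] := hmull_solve g (g * n); exists x => //.
  apply: (@hmulIr _ (f g)).
  by rewrite -hmorphM xE hmorphM Kn hmulr1 hmul1r.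
have [x xE] := hmulr_solve g (n * g); exists x => //.
apply: (@hmulI _ (f g)).
by rewrite -hmorphM xE hmorphM Kn hmulr1 hmul1r.
Qed.

Definition hom_ker : homNormal G := HomNormal hom_ker_normal.

End HomKernel.

(* Main.v *)
Require Import Defs.
From HB Require Import structures.
From mathcomp Require Import all_boot.
From mathcomp Require Import boolp.

(** Two elements of [G] lie in the same coset of [Ker f] exactly when [f] takes
    the same value on them ([coset_ker_eqP]). One direction makes the map
    sending [a (Ker f)] to [f a] well defined, the other makes it injective.
    It respects products and twists because [f] does, and its image is that
    of [f], so it is an isomorphism onto [H] once [f] is surjective.

    The delicate point is that the unit of a Hom-group is neutral only up to
    the twist: equality of cosets reads [a * n = twist b] with [n] in the
    kernel, so [f a = f b] comes out after cancelling the injective twist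
    of [H]. *)

Local Open Scope homgroup_scope.

Section KernelQuotient.
Variables (G H : homGroupType) (f : homGroupMorphism G H).

Local Notation K := (hom_ker f).

(** The equation [a * n = twist b] always has a solution [n]; applying [f] to
    it gives [f a * f n = f b * 1], and when [f a = f b] cancellation in [H]
    forces [n] into the kernel. *)
Lemma coset_ker_eqP (a b : G) : coset K a = coset K b <-> f a = f b.
Proof.
split=> [/coset_eqP[n fn1 an]|fab].
  by apply: twist_inj; rewrite [RHS]hmorph_twist -an hmorphM fn1 hmulr1.
apply/coset_eqP; have [n an] := hmulr_solve a (twist b).
exists n => //; apply: (@hmulI _ (f a)).
by rewrite -hmorphM an -hmorph_twist hmulr1 fab.
Qed.

Definition ker_factor (A : hom_quotient K) : H := f (coset_repr A).

(** Independence of the representative chosen in [ker_factor]. *)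
Lemma ker_factorE (a : G) : ker_factor (coset K a) = f a.
Proof. by apply/coset_ker_eqP; exact: coset_reprK. Qed.

Lemma ker_factor_inj : injective ker_factor.
Proof.
move=> A B; have [a <-] := coset_surj A; have [b <-] := coset_surj B.
by rewrite !ker_factorE => /coset_ker_eqP.
Qed.

Lemma ker_factorM (A B : hom_quotient K) :
  ker_factor (A * B) = ker_factor A * ker_factor B.
Proof.
have [a <-] := coset_surj A; have [b <-] := coset_surj B.
have -> : coset K a * coset K b = coset K (a * b) by exact: quotient_mulE.
by rewrite !ker_factorE hmorphM.
Qed.

Lemma ker_factor_twist (A : hom_quotient K) :
  twist (ker_factor A) = ker_factor (twist A).
Proof.
have [a <-] := coset_surj A.
have -> : twist (coset K a) = coset K (twist a) by exact: quotient_twistE.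
by rewrite !ker_factorE hmorph_twist.
Qed.

HB.instance Definition _ :=
  isHomGroupMorphism.Build (hom_quotient K) H ker_factor
    ker_factorM ker_factor_twist.

Lemma ker_factor_bij : hom_epimorphism f -> bijective ker_factor.
Proof.
move=> epi_f; pose s h := projT1 (cid (epi_f h)).
have sK h : f (s h) = h := projT2 (cid (epi_f h)).
have gK : cancel (fun h => coset K (s h)) ker_factor.
  by move=> h; rewrite ker_factorE.
by exists (fun h => coset K (s h)) => // A; apply: ker_factor_inj; rewrite gK.
Qed.

End KernelQuotient.

Theorem theorem5p9 (G H : homGroupType) (f : homGroupMorphism G H)
    (epi_f : hom_epimorphism f) :
  hom_isomorphic (hom_quotient (hom_ker f)) H.
Proof. by exists (ker_factor G H f); exact: ker_factor_bij. Qed.
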